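(* Let $p>3$ be an integer with $p\notin\{4,6\}$, and let $\lambda_p=2\cos\left(\frac{\pi}{p}\right)$. Then for no integer $m\ge 1$ is $\lambda_p^m$ an integer. *)

(* Defs.v *)
From HB Require Import structures.
From mathcomp Require Import all_boot all_order all_algebra.
From mathcomp Require Import reals trigo.

Set Implicit Arguments.
Unset Strict Implicit.
Unset Printing Implicit Defensive.

Import Order.TTheory GRing.Theory Num.Theory.
Local Open Scope ring_scope.

Definition lambda (R : realType) (p : nat) : R := 2 * cos (pi / p%:R).

(* Main.v *)
Require Import Defs.
From HB Require Import structures.
From mathcomp Require Import all_boot all_order all_algebra.
From mathcomp Require Import all_field complex ring lra zify.
From mathcomp Require Import reals trigo.

Set Implicit Arguments.
Unset Strict Implicit.
Unset Printing Implicit Defensive.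

Import Order.TTheory GRing.Theory Num.Theory.
Local Open Scope ring_scope.

(* Put zeta = exp (i pi / p).  If (2 cos (pi / p))^m = N is an integer, then   *)
(* zeta is a root of (X^2 + 1)^m - N X^m.  As the cyclotomic polynomial        *)
(* 'Phi_(2p) is irreducible, so is zeta^k for every k coprime to 2p, i.e.      *)
(* (2 cos (k pi / p))^m = N as well.  Unless p is 1, 2, 3, 4 or 6, some such k *)
(* satisfies 1 < k < p - 1, and then |cos (k pi / p)| < cos (pi / p).          *)

(** [root_prim_conj] is the irreducibility argument, [root_cis] translates between the rational
    polynomial and the real equation, [exists_coprime_between] supplies [k], and [norm_cos_lt] gives
    the contradiction: two numbers of different absolute value cannot have the same positive
    power. *)

Lemma root_Phi (F : numFieldType) (n : nat) (z : F) :
  n.-primitive_root z -> root (map_poly intr 'Phi_n) z.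
Proof.
move=> prz; have n0 := prim_order_gt0 prz.
have := congr1 (map_poly (intr : int -> F)) (prod_Cyclotomic n0).
rewrite rmorph_prod rmorphB rmorph1 /= map_polyXn => E.
have : root ('X^n - 1) z by rewrite rootE !hornerE prim_expr_order ?subrr.
rewrite -E /root horner_prod prodf_seq_eq0 => /hasP[d].
rewrite -dvdn_divisors //= => dn /= Hd.
have d0 : (0 < d)%N by apply: dvdn_gt0 dn.
have zd : z ^+ d = 1.
  have := congr1 (map_poly (intr : int -> F)) (prod_Cyclotomic d0).
  rewrite rmorph_prod rmorphB rmorph1 /= map_polyXn.
  rewrite (big_rem d) /= -?dvdn_divisors // => /(congr1 (horner^~ z)).
  by rewrite hornerM (eqP Hd) mul0r !hornerE => /esym/eqP; rewrite subr_eq0 => /eqP.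
suff <- : d = n by [].
by apply/eqP; rewrite eqn_dvd dn (prim_order_dvd prz) zd eqxx.
Qed.

(** The minimal polynomial [p] over the rationals is that of an auxiliary primitive root [x] in
    [algC]. It equals ['Phi_n], so it kills both [z] and [w]; it remains to see that it divides
    [q]. *)
Lemma root_prim_conj (F : numFieldType) (n : nat) (z w : F) (q : {poly rat}) :
  n.-primitive_root z -> n.-primitive_root w ->
  root (map_poly ratr q) z -> root (map_poly ratr q) w.
Proof.
move=> prz prw qz.
have [x prx] := C_prim_root_exists (prim_order_gt0 prz).
have [p [Dp _] dvp] := minCpolyP x.
have DpF : map_poly ratr p = map_poly intr 'Phi_n :> {poly F}.
  have -> : p = map_poly intr 'Phi_n.
    apply: (@map_poly_inj _ _ (ratr : rat -> algC)).
    rewrite -Dp (minCpoly_cyclotomic prx) -(Cintr_Cyclotomic prx) -map_poly_comp.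
    by apply: eq_map_poly => a /=; rewrite ratr_int.
  by rewrite -map_poly_comp; apply: eq_map_poly => a /=; rewrite ratr_int.
have pz : root (map_poly ratr p) z by rewrite DpF root_Phi.
have pw : root (map_poly ratr p) w by rewrite DpF root_Phi.
have p0 : p != 0 by rewrite -(map_poly_eq0 (ratr : rat -> algC)) -Dp minCpoly_eq0.
suff /dvdpP[r ->] : p %| q by rewrite rmorphM rootM pw orbT.
have dz : root (map_poly ratr (gcdp p q)) z by rewrite gcdp_map root_gcd pz qz.
have /dvdpP[e pE] := dvdp_gcdl p q.
have : root (map_poly ratr p) x by rewrite dvp.
rewrite {1}pE rmorphM rootM !dvp => /orP[/dvdpP[f fE]|]; last first.
  by move/dvdp_trans; apply; apply: dvdp_gcdr.
(* Here [p] divides its own cofactor, so [gcdp p q] is a unit, although it vanishes at [z]. *)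
have : p * (f * gcdp p q) = p * 1.
  by rewrite mulr1 mulrA [p * f]mulrC -fE -pE.
move/(mulfI p0)/(congr1 (map_poly (ratr : rat -> F)))/(congr1 (horner^~ z)).
rewrite rmorphM rmorph1 hornerM (eqP dz) mulr0 hornerC => /esym/eqP.
by rewrite oner_eq0.
Qed.

Section Cis.
Variable R : realType.
Implicit Types (t : R) (m k : nat).
Local Open Scope complex_scope.

Definition cis t : R[i] := cos t +i* sin t.

Lemma cisX t k : cis t ^+ k = cis (t *+ k).
Proof.
elim: k => [|k IHk]; first by rewrite expr0 mulr0n /cis cos0 sin0.
rewrite exprS IHk mulrS /cis cosD sinD; simpc.
by congr (_ +i* _); rewrite addrC // [cos t * _]mulrC.
Qed.

Lemma cis_neq0 t : cis t != 0.
Proof.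
apply/eqP => -[c0 s0]; have := cos2Dsin2 t.
by rewrite c0 s0 !expr0n addr0 => /esym/eqP; rewrite oner_eq0.
Qed.

Lemma cis_sqrD1 t : cis t ^+ 2 + 1 = cis t * (2 * cos t)%:C.
Proof.
rewrite expr2 /cis; simpc; apply/eqP; rewrite eq_complex /=; apply/andP; split.
  by apply/eqP; have := cos2Dsin2 t; nra.
by apply/eqP; ring.
Qed.

(** By [cis_sqrD1] the value at [cis t] is [cis t ^+ m] times [(2 * cos t) ^+ m - N]. *)
Lemma root_cis t m (N : int) :
  root (map_poly ratr (('X^2 + 1) ^+ m - N%:~R *: 'X^m)) (cis t) =
  ((2 * cos t) ^+ m == N%:~R).
Proof.
rewrite rmorphB rmorphXn rmorphD /= map_polyZ !map_polyXn rmorph1 rmorph_int.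
rewrite rootE !hornerE cis_sqrD1 exprMn mulrC -mulrBl mulf_eq0.
rewrite [_ ^+ m == 0]expf_eq0 (negPf (cis_neq0 t)) andbF orbF subr_eq0.
by rewrite -rmorphXn -(rmorph_int (real_complex R)) (inj_eq (@complexI R)).
Qed.

Lemma prim_root_cis (p : nat) : (0 < p)%N ->
  (p.*2).-primitive_root (cis (pi / p%:R)).
Proof.
move=> p0; have pp : 0 < p%:R :> R by rewrite ltr0n.
have pip := pi_gt0 R.
have pE : (pi / p%:R) *+ p = pi :> R by rewrite -mulr_natr divfK ?gt_eqF.
have z1 : cis (pi / p%:R) ^+ p.*2 = 1.
  by rewrite cisX -muln2 mulrnA pE /cis cos2pi sin2pi.
have [|d prd dp] := prim_order_exists _ z1; first by rewrite double_gt0.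
have d0 := prim_order_gt0 prd.
suff -> : p.*2 = d by [].
(* A proper divisor [d] of [2p] is at most [p], so the angle [d pi / p] lies in [(0, pi]], where
   [cis] never equals 1. *)
case/dvdnP: dp => [[|[|j]]] jE; [lia|lia|].
have dlep : (d <= p)%N by nia.
have := prim_expr_order prd; rewrite cisX => -[c1 s0].
move: dlep; rewrite leq_eqVlt => /orP[/eqP dpE|dltp].
  by move: c1; rewrite dpE pE cospi => H; exfalso; lra.
suff : 0 < sin (pi / p%:R *+ d : R) by rewrite s0 ltxx.
have t0 : 0 < pi / p%:R :> R by rewrite divr_gt0.
apply: sin_gt0_pi; rewrite pmulrn_lgt0 // t0 /=.
by rewrite -[X in _ < X]pE ltr_pMn2l.
Qed.

(** Cosine strictly decreases on [[0, pi]], [t < k t < (p - 1) t], and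
    [cos ((p - 1) t) = - cos t]. *)
Lemma norm_cos_lt t k p : (1 < k < p.-1)%N -> t *+ p = pi ->
  `|cos (t *+ k)| < cos t.
Proof.
move=> /andP[k1 kp] tp; have pip := pi_gt0 R.
have t0 : 0 < t by rewrite -(pmulrn_lgt0 _ (_ : 0 < p)%N) ?tp //; lia.
have in_itv_mul j : (j <= p)%N -> t *+ j \in `[0, pi].
  by move=> jp; rewrite in_itv /= (mulrn_wge0 _ (ltW t0)) -tp ler_pMn2l.
have ti : t \in `[0, pi] by apply: (in_itv_mul 1); lia.
rewrite ltr_norml; apply/andP; split.
  have -> : - cos t = cos (t *+ p.-1).
    have -> : t *+ p.-1 = - t + pi.
      by rewrite -tp -[in RHS](@prednK p) ?mulrS ?addKr //; lia.
    by rewrite cosDpi cosN.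
  by rewrite ltr_cos ?in_itv_mul ?ltr_pMn2l //; lia.
by rewrite ltr_cos ?in_itv_mul -1?[X in X < _]mulr1n ?ltr_pMn2l //; lia.
Qed.

End Cis.

Lemma exists_coprime_between (p : nat) : (3 < p)%N -> p \notin [:: 4%N; 6%N] ->
  exists2 k, (1 < k < p.-1)%N & coprime k p.*2.
Proof.
rewrite !inE => p3 p46.
have coprimeE k n : coprime k n.*2 = odd k && coprime k n.
  by rewrite -mul2n coprimeMr coprimen2.
have [p_odd|p_even] := boolP (odd p).
  have k_odd : odd (p - 2) by lia.
  exists (p - 2)%N; first by lia.
  have /(congr1 (gcdn (p - 2))) : p = (2 + (p - 2))%N by lia.
  by rewrite coprimeE k_odd /coprime => ->; rewrite gcdnDr -/(coprime _ 2)
    coprimen2.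
have pE : p = p./2.*2 by lia.
(* For [p = 2q], the witness is the first odd number above [q] that is coprime to it: [q + 2] for
   odd [q], [q + 1] for even [q]. It stays below [p - 1] once [q > 3], resp. [q > 2], which excludes
   [p = 6] and [p = 4]. *)
set q := p./2 in pE; have [q_odd|q_even] := boolP (odd q).
  exists (q + 2)%N; first by lia.
  by rewrite pE !coprimeE [coprime _ q]coprime_sym /coprime gcdnDl -/(coprime q 2)
    coprimen2 q_odd oddD q_odd.
exists q.+1; first by lia.
by rewrite pE !coprimeE coprimeSn /= q_even.
Qed.

Theorem lemma14 (R : realType) (p : nat) (hp : (3 < p)%N)
    (hp46 : p \notin [:: 4%N; 6%N]) :
  forall m : nat, (1 <= m)%N -> lambda R p ^+ m \isn't a Num.int.
Proof.
move=> m m1; apply/negP => /intrP[N lamN].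
have [k k1p kp] := exists_coprime_between hp hp46.
have p0 : (0 < p)%N by lia.
have pE : (pi / p%:R) *+ p = pi :> R.
  by rewrite -mulr_natr divfK // pnatr_eq0 -lt0n.
have prz := prim_root_cis R p0.
have : root (map_poly ratr (('X^2 + 1) ^+ m - N%:~R *: 'X^m))
  (cis (pi / p%:R : R) ^+ k).
  apply: (root_prim_conj prz); first by rewrite prim_root_exp_coprime.
  by rewrite root_cis -lamN.
rewrite cisX root_cis -lamN /lambda => /eqP/(congr1 Num.norm).
have c_lt := norm_cos_lt k1p pE.
have c0 := le_lt_trans (normr_ge0 _) c_lt.
rewrite !normrX !normrM !exprMn => /mulfI.
rewrite expf_eq0 normr_eq0 pnatr_eq0 andbF => /(_ isT)/eqP.
by rewrite [`|cos (_ / _)|]gtr0_norm // eqrXn2 // ?ltW // (lt_eqF c_lt).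
Qed.
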